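(* Fix $T$ with $1<T<\tfrac43$ and $n\ge 3$. For every initial configuration $C_0$ on the $n$-vertex cycle, the PD process started from $C_0$ reaches some $i\ge 0$ with $W_i=\emptyset$, i.e. it terminates in a stable configuration.
   Context: A configuration on a graph $G=(V,E)$ is a map $C:V\to\{0,1\}$; $1$ means cooperator, $0$ means defector. The pay-off $f(a,b)$ to a player with strategy $a$ against strategy $b$ is $f(0,0)=0$, $f(0,1)=T$, $f(1,0)=0$, $f(1,1)=1$. The score of $v$ is $s(v)=\sum_{x\in N(v)} f(C(v),C(x))$. The most successful neighbours of $v$ are the vertices of $N[v]$ of maximum score (defectors taken as most successful in case of a tie between a cooperator and a defector). A vertex is weak if its strategy differs from that of its most successful neighbours; updating a vertex changes its strategy if it is currently weak and does nothing otherwise. PD process: given $C_t$, let $W_t$ be the set of weak vertices; if $W_t=\emptyset$ the process stops and $C_t$ is stable. Otherwise a uniformly random ordering of $W_t$ is chosen and the vertices are updated one at a time in that order, each with respect to the current configuration, producing $C_{t+1}$. *)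

(* Defs.v *)
From HB Require Import structures.
From mathcomp Require Import all_boot all_order all_algebra.
From mathcomp Require Import all_classical all_reals all_analysis.

Set Implicit Arguments.
Unset Strict Implicit.
Unset Printing Implicit Defensive.

Import Order.TTheory GRing.Theory Num.Theory.
Local Open Scope ring_scope.

(* Two vertices of the n-cycle are adjacent iff they differ by 1 modulo n;
   for n >= 3 this is the simple cycle on n vertices. *)
Definition cycle_adj (n : nat) : rel 'I_n :=
  [rel u v | (v == ordS u) || (u == ordS v)].

Section PrisonersDilemma.
Variables (R : realType) (T : R) (V : finType) (adj : rel V).

(* Strategies are booleans: [true] (1) = cooperator, [false] (0) = defector. *)
Definition configuration := {ffun V -> bool}.

Definition payoff (a b : bool) : R :=
  match a, b with
  | false, false => 0
  | false, true  => T
  | true,  false => 0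
  | true,  true  => 1
  end.

Definition score (C : configuration) (v : V) : R :=
  \sum_(x | adj v x) payoff (C v) (C x).

Definition closed_nbhd (v : V) : {set V} := [set u | (u == v) || adj v u].

Definition max_score_nbrs (C : configuration) (v : V) : {set V} :=
  [set u in closed_nbhd v |
    [forall w in closed_nbhd v, score C w <= score C u]].

(* A cooperator of maximum score counts as most successful only if no defector
   attains that score. Hence the most successful neighbours of v form a nonempty
   set on which C is constant. *)
Definition most_successful (C : configuration) (v : V) : {set V} :=
  [set u in max_score_nbrs C v |
    C u ==> [forall w in max_score_nbrs C v, C w]].

Definition weak (C : configuration) (v : V) : bool :=
  [exists u in most_successful C v, C u != C v].

Definition weak_set (C : configuration) : {set V} := [set v | weak C v].

Definition stable (C : configuration) : Prop := weak_set C = finset.set0.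

Definition update (C : configuration) (v : V) : configuration :=
  if weak C v then [ffun u => if u == v then ~~ C v else C u] else C.

Definition is_ordering (W : {set V}) (s : seq V) : bool := perm_eq s (enum W).

(* [pd_config C0 ord t] is C_t when [ord i] is the ordering chosen at step i.
   The only ordering of the empty set is [::], so a stopped process just repeats
   its stable configuration. *)
Fixpoint pd_config (C0 : configuration) (ord : nat -> seq V) (t : nat) :
    configuration :=
  if t is t'.+1 then foldl update (pd_config C0 ord t') (ord t') else C0.

Section Random.
Variables (d : measure_display) (Omega : measurableType d).
Variables (P : probability Omega R).

Definition history (ord : nat -> Omega -> seq V) (t : nat) (h : nat -> seq V) :
    set Omega :=
  [set w | forall i, (i < t)%N -> ord i w = h i]%classic.

(* [ord t w] is the ordering of W_t chosen at step t in the outcome w. The last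
   field says that, given all previous choices, the ordering chosen at step t is
   uniform among the #|W_t|! orderings of W_t. *)
Record pd_process (C0 : configuration) (ord : nat -> Omega -> seq V) : Prop := {
  pd_measurable : forall t s, measurable [set w | ord t w = s]%classic ;
  pd_ordering : forall t w,
    is_ordering (weak_set (pd_config C0 (ord^~ w) t)) (ord t w) ;
  pd_uniform : forall t (h : nat -> seq V),
    let W := weak_set (pd_config C0 h t) in
    is_ordering W (h t) ->
    (P (history ord t.+1 h) = P (history ord t h) * ((factorial #|W|)%:R^-1)%R%:E)%E
}.

End Random.

End PrisonersDilemma.

(* Main.v *)
Require Import Defs.
From mathcomp Require Import all_boot all_order all_algebra.
From mathcomp Require Import all_classical all_reals all_analysis.

(** On a graph of maximum degree 2 with T > 1 a defector is never weak: a
    cooperator next to it has at most one cooperating neighbour, hence scores at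
    most 1, whereas the defector itself scores at least T. So every round with a
    weak vertex strictly decreases the number of cooperators, whatever the
    orderings are. *)

Set Implicit Arguments.
Unset Strict Implicit.
Unset Printing Implicit Defensive.

Import Order.TTheory GRing.Theory Num.Theory.
Local Open Scope ring_scope.

Section MaxDegreeTwo.
Variables (R : realType) (T : R) (V : finType) (adj : rel V).
Hypotheses (T_gt1 : 1 < T) (adj_sym : symmetric adj).
Hypothesis adj_deg2 : forall v, (#|[pred x | adj v x]| <= 2)%N.

Local Notation weak := (weak T adj).
Local Notation update := (update T adj).
Local Notation pd_config := (pd_config T adj).

Lemma payoff_ge0 a b : 0 <= payoff T a b.
Proof. by case: a; case: b => //=; rewrite (le_trans ler01) ?ltW. Qed.

Lemma score_defector_ge (C : configuration V) v u :
  ~~ C v -> C u -> adj v u -> T <= score T adj C v.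
Proof.
move=> /negbTE Cv Cu vu; rewrite /score (bigD1 u) //= Cv Cu /= lerDl.
by apply: sumr_ge0 => x _; exact: (payoff_ge0 false).
Qed.

(** The defector [v] pays [u] nothing, and the degree bound leaves at most one other neighbour,
    which pays at most 1. *)
Lemma score_cooperator_le1 (C : configuration V) u v :
  C u -> ~~ C v -> adj u v -> score T adj C u <= 1.
Proof.
move=> Cu /negbTE Cv uv; rewrite /score (bigD1 v) //= Cu Cv /= add0r.
apply: (@le_trans _ _ (\sum_(x | adj u x && (x != v)) 1)).
  by apply: ler_sum => x _; case: (C x).
rewrite sumr_const (ler_nat _ _ 1).
have := adj_deg2 u; rewrite (cardD1 v [pred x | adj u x]) inE uv add1n ltnS.
apply: leq_trans; apply: subset_leq_card.
by apply/fintype.subsetP => x; rewrite !inE andbC.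
Qed.

Lemma weak_cooperator (C : configuration V) v : weak C v -> C v.
Proof.
apply: contraTT => Cv; apply/negP => /existsP[u /andP[]].
rewrite !inE (negbTE Cv) eqbF_neg negbK.
move=> /andP[/andP[/orP[/eqP->|vu] /forallP umax] _] Cu; first by rewrite Cu in Cv.
(* As [v] lies in its own closed neighbourhood, maximality of [u] would put the score of [v], at
   least [T], below that of [u], at most 1. *)
have := umax v; rewrite inE eqxx /= leNgt => /negP; apply.
apply: le_lt_trans (lt_le_trans T_gt1 (score_defector_ge Cv Cu vu)).
by apply: score_cooperator_le1 Cu Cv _; rewrite adj_sym.
Qed.

Lemma update_le (C : configuration V) v x : update C v x -> C x.
Proof.
rewrite /update; case: ifP => // /weak_cooperator Cv.
by rewrite ffunE Cv; case: eqP.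
Qed.

Lemma foldl_update_le (s : seq V) (C : configuration V) x :
  foldl update C s x -> C x.
Proof. by elim: s C => //= v s IHs C /IHs/update_le. Qed.

(** Later vertices of [s] may have ceased to be weak when their turn comes, but the first one is
    updated with respect to [C] itself. It therefore does become a defector, and no later update
    turns it back. *)
Lemma card_cooperators_round (C : configuration V) (s : seq V) :
  is_ordering (weak_set T adj C) s -> weak_set T adj C != finset.set0 ->
  (#|[pred x | foldl update C s x]| < #|[pred x | C x]|)%N.
Proof.
move=> /perm_mem s_weak /set0Pn[v0 v0_weak].
case: s s_weak => [/(_ v0)|v s s_weak]; first by rewrite mem_enum v0_weak.
have v_weak : weak C v by have := s_weak v; rewrite mem_enum inE eqxx inE.
apply: proper_card; apply/properP; split.
  by apply/fintype.subsetP => x; rewrite !inE; exact: foldl_update_le.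
exists v; rewrite !inE; first exact: weak_cooperator.
apply/negP => /= /foldl_update_le.
by rewrite /update v_weak ffunE eqxx (weak_cooperator v_weak).
Qed.

Lemma pd_config_stable (C0 : configuration V) (ord : nat -> seq V) :
  (forall t, is_ordering (weak_set T adj (pd_config C0 ord t)) (ord t)) ->
  exists i, stable T adj (pd_config C0 ord i).
Proof.
move=> ordP.
(* Induction on a strict bound [m] for the number of cooperators, with the time [t] left free;
   [m = 0] is vacuous. *)
suff IH m t : (#|[pred x | pd_config C0 ord t x]| < m)%N ->
    exists i, stable T adj (pd_config C0 ord i).
  exact: (IH _ 0 (ltnSn _)).
elim: m t => // m IHm t le_m.
have [|W_neq0] := eqVneq (weak_set T adj (pd_config C0 ord t)) finset.set0.
  by exists t.
by apply: (IHm t.+1); apply: leq_trans (card_cooperators_round (ordP t) W_neq0) _.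
Qed.

End MaxDegreeTwo.

Lemma cycle_adj_sym n : symmetric (@cycle_adj n).
Proof. by move=> u v; rewrite /cycle_adj /= orbC. Qed.

Lemma cycle_adj_deg2 n (v : 'I_n) : (#|[pred x | cycle_adj v x]| <= 2)%N.
Proof.
(* Counting the entries of a list avoids having to show that the two neighbours are distinct. *)
apply: leq_trans (card_size [:: ordS v; ord_pred v]).
apply: subset_leq_card; apply/fintype.subsetP => x; rewrite !inE.
by case/orP => [->|/eqP->] //; rewrite ordSK eqxx orbT.
Qed.

Unset Implicit Arguments.

Theorem theorem4p3 (R : realType) (T : R) (n : nat)
    (hT1 : 1 < T) (hT2 : T < 4%:R / 3%:R) (hn : (3 <= n)%N)
    (d : measure_display) (Omega : measurableType d) (P : probability Omega R)
    (C0 : configuration 'I_n) (ord : nat -> Omega -> seq 'I_n)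
    (hproc : pd_process T (@cycle_adj n) P C0 ord) (w : Omega) :
  exists i : nat, stable T (@cycle_adj n) (pd_config T (@cycle_adj n) C0 (ord^~ w) i).
Proof.
apply: pd_config_stable hT1 (@cycle_adj_sym n) (@cycle_adj_deg2 n) _ _ _.
(* [pd_ordering] holds in every outcome, so termination is sure, not merely almost sure. *)
by move=> t; exact: (pd_ordering hproc).
Qed.
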